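(* If $(t_k)$ and $(\tau_k)$, $k=0,1,2,\ldots$, are a binomial-transform pair of the first kind, then so are the sequences \[ a_k=\frac{1}{k+1}\sum_{j=0}^k\frac{t_j}{j+1}\quad\text{and}\quad \alpha_k=\frac{1}{(k+1)^2}\sum_{j=0}^k\tau_j,\qquad k=0,1,2,\ldots. \]
   Context: Two sequences $(t_k)_{k\ge0}$ and $(\tau_k)_{k\ge0}$ of complex numbers form a binomial-transform pair of the first kind if $\tau_n=\sum_{k=0}^n(-1)^k\binom nk t_k$ for every non-negative integer $n$. *)

(* Defs.v *)
From mathcomp Require Import all_boot all_order all_algebra.
From mathcomp Require Import complex reals.

Set Implicit Arguments.
Unset Strict Implicit.
Unset Printing Implicit Defensive.

Import GRing.Theory Num.Theory.
Local Open Scope ring_scope.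
Local Open Scope complex_scope.

(* The complex numbers are [R[i]], for an arbitrary model [R] of the reals. *)
Definition binomial_transform_pair1 (R : realType) (t tau : nat -> R[i]) : Prop :=
  forall n : nat,
    tau n = \sum_(0 <= k < n.+1) (-1) ^+ k * ('C(n, k))%:R * t k.

(* Main.v *)
Require Import Defs.
From mathcomp Require Import all_boot all_order all_algebra.
From mathcomp Require Import complex reals.

Import GRing.Theory Num.Theory.
Local Open Scope ring_scope.
Local Open Scope complex_scope.

(** Write B for the binomial transform and put w_n(x) = \sum_(k <= n) (-1)^k
    C(n+1, k+1) x_k.  The absorption identity C(n, k) / (k+1) = C(n+1, k+1) / (n+1)
    gives B(x_k / (k+1))_n = w_n(x) / (n+1), while Pascal's rule evaluates w_n in
    two ways: it is the n-th partial sum of B(x), and if x is the sequence of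
    partial sums of u, it is B(u)_n.  With u_k = t_k / (k+1), one obtains
    B(a)_n = w_n(\sum u) / (n+1) = B(u)_n / (n+1) = w_n(t) / (n+1)^2 = alpha_n. *)

Definition binomial_transform (F : pzRingType) (x : nat -> F) (n : nat) : F :=
  \sum_(0 <= k < n.+1) (-1) ^+ k * ('C(n, k))%:R * x k.

Definition shifted_binomial_transform (F : pzRingType) (x : nat -> F) (n : nat) : F :=
  \sum_(0 <= k < n.+1) (-1) ^+ k * ('C(n.+1, k.+1))%:R * x k.

Lemma binomial_transform_div_succ (F : numFieldType) (x : nat -> F) (n : nat) :
  binomial_transform F (fun k => x k / k.+1%:R) n =
  shifted_binomial_transform F x n / n.+1%:R.
Proof.
rewrite /binomial_transform /shifted_binomial_transform mulr_suml.
apply: eq_bigr => k _; rewrite -!mulrA; congr (_ * _).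
rewrite mulrCA [RHS]mulrCA; congr (_ * _).
apply: (canRL (mulfK _)); first by rewrite pnatr_eq0.
rewrite mulrAC; apply: (canLR (mulfK _)); first by rewrite pnatr_eq0.
(* With denominators cleared, this is absorption in [nat]. *)
by rewrite -!natrM mulnC mul_bin_diag mulnC.
Qed.

Lemma sum_binomial_transform (F : pzRingType) (x : nat -> F) (n : nat) :
  \sum_(0 <= j < n.+1) binomial_transform F x j = shifted_binomial_transform F x n.
Proof.
elim: n => [|n IHn].
  by rewrite /binomial_transform /shifted_binomial_transform !big_nat1.
rewrite big_nat_recr //= IHn.
(* The added term [k = n.+1] vanishes, so Pascal's rule applies termwise over one range. *)
have -> : shifted_binomial_transform F x n =
    \sum_(0 <= k < n.+2) (-1) ^+ k * ('C(n.+1, k.+1))%:R * x k.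
  by rewrite big_nat_recr //= bin_small // mulr0 mul0r addr0.
rewrite -big_split; apply: eq_bigr => k _ /=.
by rewrite -mulrDl -mulrDr -natrD -binS.
Qed.

(** Summation by parts: write [u k] as a difference of partial sums, shift the index in the
    subtracted sum, whose sign then flips, and recombine by Pascal's rule. *)
Lemma shifted_binomial_transform_psum (F : pzRingType) (u : nat -> F) (n : nat) :
  shifted_binomial_transform F (fun k => \sum_(0 <= j < k.+1) u j) n =
  binomial_transform F u n.
Proof.
(* [S k] stops before [u k], so [S 0 = 0] kills the boundary term of the shift. *)
pose S k := \sum_(0 <= j < k) u j.
have -> : binomial_transform F u n =
    \sum_(0 <= k < n.+1) (-1) ^+ k * ('C(n, k))%:R * S k.+1 -
    \sum_(0 <= k < n.+1) (-1) ^+ k * ('C(n, k))%:R * S k.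
  rewrite -sumrB; apply: eq_bigr => k _.
  by rewrite -mulrBr /S [in X in X - _]big_nat_recr //= [X in X - _]addrC addrK.
rewrite [X in _ - X]big_nat_recl // [S 0%N]big_geq // mulr0 add0r.
have -> : \sum_(0 <= k < n) (-1) ^+ k.+1 * ('C(n, k.+1))%:R * S k.+1 =
    - \sum_(0 <= k < n.+1) (-1) ^+ k * ('C(n, k.+1))%:R * S k.+1.
  rewrite big_nat_recr //= bin_small // mulr0 mul0r addr0 -sumrN.
  by apply: eq_bigr => k _; rewrite exprS mulN1r !mulNr.
rewrite opprK -big_split; apply: eq_bigr => k _ /=.
by rewrite -mulrDl -mulrDr -natrD addnC -binS.
Qed.

Theorem theorem19 (R : realType) (t tau : nat -> R[i])
  (h : binomial_transform_pair1 t tau) :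
  binomial_transform_pair1
    (fun k : nat => 1 / (k.+1)%:R * \sum_(0 <= j < k.+1) t j / (j.+1)%:R)
    (fun k : nat => 1 / (k.+1)%:R ^+ 2 * \sum_(0 <= j < k.+1) tau j).
Proof.
move=> n; rewrite (eq_bigr (binomial_transform _ t)) => [|j _]; last exact: h.
rewrite sum_binomial_transform.
transitivity (binomial_transform _
    (fun k => (\sum_(0 <= j < k.+1) t j / j.+1%:R) / k.+1%:R) n).
  (* Absorption is used first on the partial sums, then on [t]; each use gives one factor
     [1 / n.+1]. *)
  rewrite binomial_transform_div_succ shifted_binomial_transform_psum.
  by rewrite binomial_transform_div_succ mulrC mul1r expr2 invfM mulrA.
by apply: eq_bigr => k _; rewrite mul1r [_^-1 * _]mulrC.
Qed.
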